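(* Let $G$ be a finite simple graph with $n$ edges and let $r\ge 2$ be an integer. Then $\omega(I_{\mathcal{M}_G})\le r$ if and only if for every $\mathbf{a}\in\mathbb{Z}_{\ge 0}^n$, every $k$, and all $k$-edge-colorings $f$ and $g$ of the edge-replication multigraph $G^{(e)}_{\mathbf{a}}$, one has $f\sim_r g$.
   Context: Graphs are finite and simple; multigraphs have no loops. Let $G$ have edge set $E(G)=\{e_1,\dots,e_n\}$. A matching of $G$ is a (possibly empty) set of pairwise non-adjacent edges. For $M\subset E(G)$ put $\rho(M)=\sum_{e_j\in M}\mathbf{e}_j\in\mathbb{R}^n$. The matching polytope is $\mathcal{M}_G=\mathrm{conv}\{\rho(M): M \text{ a matching of } G\}\subset\mathbb{R}^n$. Toric ideal: for a lattice polytope $\mathcal{P}\subset\mathbb{R}^n_{\ge0}$ with $\mathcal{P}\cap\mathbb{Z}^n=\{\mathbf{a}_1,\dots,\mathbf{a}_N\}$ and a field $\mathbb{K}$, $I_{\mathcal{P}}$ is the kernel of the $\mathbb{K}$-algebra map $\mathbb{K}[x_1,\dots,x_N]\to\mathbb{K}[t_1,\dots,t_n,s]$, $x_i\mapsto \mathbf{t}^{\mathbf{a}_i}s$, with $\deg x_i=1$. For a homogeneous ideal $I$, $\omega(I)$ is the maximal degree of minimal generators of $I$; by convention $\omega(\{0\})=2$ (so $\omega(I_{\mathcal P})\ge 2$ always). For $\mathbf{a}=(a_1,\dots,a_n)\in\mathbb{Z}_{\ge0}^n$, the edge-replication multigraph $G^{(e)}_{\mathbf{a}}$ is the multigraph on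 $V(G)$ having $a_i$ parallel copies of the edge $e_i$ for each $i$ (none if $a_i=0$). A $k$-edge-coloring of a multigraph is an assignment of colors from $\{1,\dots,k\}$ to the edges such that distinct edges sharing a vertex get different colors (not all colors need be used). For a $k$-edge-coloring $f$ and a color $j$, $M^{(e)}(f,j)$ is the set of edges of color $j$. Two $k$-edge-colorings $f,g$ differ by an $m$-colored subgraph if there is a set $S$ of $m$ colors with $M^{(e)}(f,j)\ne M^{(e)}(g,j)$ for $j\in S$ and $M^{(e)}(f,j)=M^{(e)}(g,j)$ for $j\notin S$. Write $f\sim_r g$ if there is a sequence $f=f_0,f_1,\dots,f_s=g$ of $k$-edge-colorings of the multigraph such that $f_i$ differs from $f_{i-1}$ by a $k_i$-colored subgraph with $k_i\le r$ for each $i$. *)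

(* Defs.v *)
From HB Require Import structures.
From mathcomp Require Import all_boot all_order all_algebra.
From mathcomp Require Import mpoly.
From Stdlib Require Import ClassicalEpsilon.

Set Implicit Arguments.
Unset Strict Implicit.
Unset Printing Implicit Defensive.

Import GRing.Theory Num.Theory.
Local Open Scope ring_scope.

(* A finite simple graph is a symmetric irreflexive relation [adj] on a finite
   type; an edge is the two-element set of its ends. *)
Section Graph.
Variables (V : finType) (adj : rel V).

Definition edge_set : {set {set V}} :=
  [set A | [exists x, exists y, adj x y && (A == [set x; y])]].

(* Elements of [edge_set] are adjacent when they meet, so pairwise
   non-adjacency of the edges of [M] is [trivIset M]. *)
Definition is_matching (M : {set {set V}}) : bool :=
  (M \subset edge_set) && trivIset M.

Definition edge_labelling (n : nat) (e : 'I_n -> {set V}) : Prop :=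
  injective e /\ [set e j | j : 'I_n] = edge_set.

End Graph.

Definition conv_hull (R : realFieldType) (n : nat) (T : finType) (A : {set T})
    (v : T -> 'rV[R]_n) (x : 'rV[R]_n) : Prop :=
  exists c : T -> R,
    [/\ forall i, i \in A -> 0 <= c i,
        \sum_(i in A) c i = 1 &
        x = \sum_(i in A) c i *: v i].

Definition rho (R : realFieldType) (V : finType) (n : nat)
    (e : 'I_n -> {set V}) (M : {set {set V}}) : 'rV[R]_n :=
  \sum_(j < n | e j \in M) delta_mx 0 j.

Definition matching_polytope (R : realFieldType) (V : finType) (adj : rel V)
    (n : nat) (e : 'I_n -> {set V}) : 'rV[R]_n -> Prop :=
  conv_hull [set M | is_matching adj M] (rho R e).
Arguments matching_polytope R {V} adj {n} e _.

(* [a] lists without repetition the points of [P] with integer coordinates.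
   The polytopes considered lie in the nonnegative orthant, whence the
   exponent vectors. *)
Definition lattice_points (R : realFieldType) (n : nat)
    (P : 'rV[R]_n -> Prop) (N : nat) (a : 'I_N -> 'X_{1..n}) : Prop :=
  injective a /\
  forall z : 'rV[int]_n,
    P (\row_j (z 0 j)%:~R) <-> exists i : 'I_N, z = \row_j (a i j)%:Z.

Section ToricIdeal.
Variables (K : fieldType) (n N : nat) (a : 'I_N -> 'X_{1..n}).

(* In [{mpoly K[n + 1]}] the first [n] variables are the t_j and the last
   one is s. *)
Definition toric_monomial (i : 'I_N) : {mpoly K[n + 1]} :=
  (\prod_(j < n) 'X_(lshift 1 j) ^+ a i j) * 'X_(rshift n ord0).

Definition toric_ideal : {pred {mpoly K[N]}} :=
  [pred p | p \mPo [tuple toric_monomial i | i < N] == 0].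

End ToricIdeal.
Arguments toric_ideal K {n N} a.

Section Omega.
Variables (K : fieldType) (N : nat).
Implicit Types (I : {pred {mpoly K[N]}}) (S : seq {mpoly K[N]}).

Definition generates S I : Prop :=
  forall p, p \in I <->
    exists c : {mpoly K[N]} -> {mpoly K[N]}, p = \sum_(q <- S) c q * q.

Definition minimal_generators S I : Prop :=
  [/\ uniq S,
      forall p, p \in S -> exists d, p \is d.-homog,
      generates S I &
      forall p, p \in S -> ~ generates (rem p S) I].

(* [(msize p).-1] is the total degree of a nonzero [p]; a minimal generator
   is never 0. *)
Definition is_omega I (w : nat) : Prop :=
  ((forall p, p \in I -> p = 0) /\ w = 2%N) \/
  (~ (forall p, p \in I -> p = 0) /\
   exists2 S, minimal_generators S I & w = (\max_(p <- S) (msize p).-1)%N).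

(* For a homogeneous ideal a value satisfying [is_omega] exists by Hilbert's
   basis theorem and is unique by the graded Nakayama lemma. *)
Definition omega I : nat := epsilon (inhabits 0%N) (is_omega I).

End Omega.

(* A loopless multigraph is given by finite types [V] of vertices and [E] of
   edges, and the map [ends] sending an edge to its two-element set of ends. *)
Section EdgeColoring.
Variables (V E : finType) (ends : E -> {set V}) (k : nat).

Definition proper_coloring (f : {ffun E -> 'I_k}) : bool :=
  [forall x, forall y,
     (x != y) && ~~ [disjoint ends x & ends y] ==> (f x != f y)].

Definition edge_coloring := {f : {ffun E -> 'I_k} | proper_coloring f}.

Definition color_class (f : edge_coloring) (j : 'I_k) : {set E} :=
  [set x | val f x == j].

Definition differ_by (m : nat) (f g : edge_coloring) : bool :=
  [exists S : {set 'I_k}, (#|S| == m) &&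
     [forall j, (j \in S) == (color_class f j != color_class g j)]].

Definition color_step (r : nat) : rel edge_coloring :=
  fun f g => [exists m : 'I_r.+1, differ_by m f g].

(* [connect] is the reflexive transitive closure. *)
Definition color_equiv (r : nat) : rel edge_coloring :=
  connect (color_step r).

End EdgeColoring.

Section EdgeReplication.
Variables (V : finType) (n : nat) (e : 'I_n -> {set V}) (b : 'I_n -> nat).

Definition replicated_edge : finType := {j : 'I_n & 'I_(b j)}.

Definition replicated_ends (x : replicated_edge) : {set V} := e (tag x).

End EdgeReplication.
Arguments replicated_ends {V n} e b _.

(* Main.v *)
Require Import Defs.
From HB Require Import structures.
From mathcomp Require Import all_boot all_order all_algebra.
From mathcomp Require Import mpoly perm.
From Stdlib Require Import ClassicalEpsilon Relations.

Set Implicit Arguments.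
Unset Strict Implicit.
Unset Printing Implicit Defensive.

Import Order.TTheory GRing.Theory Num.Theory.
Local Open Scope ring_scope.

(* The integer points of the matching polytope are the vertices [rho M], so the
   variables of the toric ring are the matchings, and a [k]-edge-coloring of an
   edge-replication multigraph is, up to permuting parallel edges and colors, a
   monomial of degree [k] whose toric image records the multiplicities.  A
   change of at most [r] colors replaces a factor of degree at most [r] by
   another factor with the same toric image.  It remains to see that the ideal
   is generated in degrees at most [r] iff any two monomials with the same
   image are joined by such replacements.  If they are, the binomial of the two
   monomials telescopes into multiples of binomials of degree at most [r].
   Conversely, if the ideal is generated in degrees at most [r], the linear
   form adding up the coefficients of the monomials joined to a given [u]
   vanishes on the ideal, hence on each binomial ['X_[u] - 'X_[v]], so that [v]
   is joined to [u]. *)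

(** * Dickson's lemma *)

(** Induction on [fs]. A basis [B] for the remaining functions handles every point where [f] is at
    least [M], its maximum on [B]; each of the finitely many slices [f x = M'] with [M' < M]
    receives a basis of its own. *)
Lemma dickson (T : eqType) (fs : seq (T -> nat)) (P : T -> Prop) :
  exists B : seq T, (forall x, x \in B -> P x) /\
    forall x, P x -> exists2 b, b \in B & all (fun f => f b <= f x)%N fs.
Proof.
elim: fs P => [|f fs IH] P.
  case: (excluded_middle_informative (exists x, P x)) => [[x Px]|nP].
    exists [:: x]; split=> [y|y _]; first by rewrite inE => /eqP->.
    by exists x; rewrite ?mem_head.
  by exists [::]; split=> // x Px; case: nP; exists x.
have [B [BP Bmin]] := IH P.
pose M := (\max_(b <- B) f b)%N.
have [C [CP Cmin]] : exists C : seq T, (forall x, x \in C -> P x) /\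
    forall x, P x -> (f x < M)%N ->
      exists2 b, b \in C & all (fun g => g b <= g x)%N (f :: fs).
  elim: M => [|M' [C [CP Cmin]]]; first by exists [::].
  have [D [DP Dmin]] := IH (fun x => P x /\ f x = M').
  exists (C ++ D); split=> [x|x Px].
    by rewrite mem_cat => /orP[/CP//|/DP[]].
  rewrite ltnS leq_eqVlt => /orP[/eqP fx|fx].
    have [b bD leb] := Dmin x (conj Px fx).
    exists b; first by rewrite mem_cat bD orbT.
    by rewrite /= leb andbT (DP b bD).2 fx.
  by have [b bC leb] := Cmin x Px fx; exists b; rewrite // mem_cat bC.
exists (B ++ C); split=> [x|x Px].
  by rewrite mem_cat => /orP[/BP|/CP].
have [fx|fx] := ltnP (f x) M.
  by have [b bC leb] := Cmin x Px fx; exists b; rewrite // mem_cat bC orbT.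
have [b bB leb] := Bmin x Px; exists b; first by rewrite mem_cat bB.
by rewrite /= leb andbT (leq_trans _ fx) // /M leq_bigmax_seq.
Qed.

(** * Finite generating sets of graded ideals *)

Section Span.
Variables (K : fieldType) (N : nat).
Implicit Types (S : seq {mpoly K[N]}) (p q : {mpoly K[N]}).

Definition in_span S p : Prop :=
  exists c : {mpoly K[N]} -> {mpoly K[N]}, p = \sum_(q <- S) c q * q.

Lemma in_span0 S : in_span S 0.
Proof. by exists (fun=> 0); rewrite big1 // => q _; rewrite mul0r. Qed.

Lemma in_spanD S p q : in_span S p -> in_span S q -> in_span S (p + q).
Proof.
move=> [c ->] [d ->]; exists (fun x => c x + d x).
by rewrite -big_split; apply: eq_bigr => x _; rewrite mulrDl.
Qed.

Lemma in_spanM S p q : in_span S p -> in_span S (q * p).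
Proof.
move=> [c ->]; exists (fun x => q * c x).
by rewrite mulr_sumr; apply: eq_bigr => x _; rewrite mulrA.
Qed.

(** Coefficients are attached to polynomials, not to positions in [S], so a repeated generator would
    enter with a multiplicity that may vanish in [K]; [uniq] excludes this. *)
Lemma in_span_mem S p : uniq S -> p \in S -> in_span S p.
Proof.
move=> uS pS; exists (fun x => (x == p)%:R).
rewrite (big_rem p) //= eqxx mul1r big_seq big1 ?addr0 // => x.
by rewrite mem_rem_uniq // !inE => /andP[/negbTE-> _]; rewrite mul0r.
Qed.

Lemma in_span_sum (I : eqType) (s : seq I) (F : I -> {mpoly K[N]}) S :
  (forall i, i \in s -> in_span S (F i)) -> in_span S (\sum_(i <- s) F i).
Proof.
move=> sF; rewrite big_seq; elim/big_ind: _ => //.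
  exact: in_span0.
by move=> x y; apply: in_spanD.
Qed.

Lemma in_span_trans S S' p :
  (forall q, q \in S -> in_span S' q) -> in_span S p -> in_span S' p.
Proof.
move=> SS' [c ->]; apply: in_span_sum => q qS.
by apply: in_spanM; apply: SS'.
Qed.

(** Redundant generators are dropped one at a time, which stops because the size decreases. *)
Lemma minimal_generators_exists S (I : {pred {mpoly K[N]}}) :
    uniq S -> (forall p, p \in S -> exists d, p \is d.-homog) ->
    generates S I ->
  exists S', minimal_generators S' I.
Proof.
elim: {S}(size S).+1 {-2}S (ltnSn (size S)) => // m IH S leS uS hS gS.
case: (excluded_middle_informative
  (exists2 p, p \in S & generates (rem p S) I)) => [[p pS gp]|noP].
  apply: (IH (rem p S)) => //; last 2 first.
  - exact: rem_uniq.
  - by move=> q /mem_rem; apply: hS.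
  by rewrite size_rem //; move: leS; case: (S) pS.
by exists S; split=> // p pS gp; apply: noP; exists p.
Qed.

Lemma pihomogM d e p q : q \is e.-homog ->
  pihomog mdeg d (p * q) =
    if (e <= d)%N then pihomog mdeg (d - e) p * q else 0.
Proof.
move=> hq; rewrite [p in LHS]mpolyE mulr_suml linear_sum /=.
have hM (m : 'X_{1..N}) : 'X_[m] * q \is (mdeg m + e).-homog.
  by apply: dhomogM; rewrite ?dhomogX.
have E (m : 'X_{1..N}) : pihomog mdeg d ((p@_m *: 'X_[m]) * q) =
    if (mdeg m + e == d)%N then (p@_m *: 'X_[m]) * q else 0.
  rewrite -scalerAl linearZ /=.
  case: eqP => [<-|/eqP ne]; first by rewrite pihomog_dE.
  by rewrite (pihomog_ne0 ne) ?scaler0.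
under eq_bigr do rewrite E.
case: leqP => [led|gtd].
  rewrite -big_mkcond pihomogE mulr_suml; apply: eq_bigl => m.
  by rewrite -[in LHS](subnK led) eqn_add2r.
by rewrite big1 // => m _; rewrite gtn_eqF // (leq_trans gtd) ?leq_addl.
Qed.

(* Graded Nakayama: a generator of degree larger than [r] cannot contribute to
   elements of degree at most [r], so it would be redundant. *)
Lemma minimal_generators_deg S S' (I : {pred {mpoly K[N]}}) r :
    minimal_generators S I -> generates S' I -> uniq S' ->
    (forall q, q \in S' -> exists2 d, (d <= r)%N & q \is d.-homog) ->
  forall p, p \in S -> ((msize p).-1 <= r)%N.
Proof.
move=> [uS hS gS minS] gS' uS' hS' p pS.
rewrite leqNgt; apply/negP => ltr.
apply: (minS p pS) => q; split; last first.
  move=> [c ->]; apply/gS.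
  apply: (@in_span_trans (rem p S)); last by exists c.
  by move=> x /mem_rem xS; apply: in_span_mem.
have [dp hp0] := hS p pS.
have hp : p \is (msize p).-1.-homog := dhomog_msize hp0.
move/gS' => [c ->]; apply: in_span_sum => x xS'; apply: in_spanM.
have [d ledr hx] := hS' x xS'.
have [c' xE] : in_span S x by apply/gS/gS'; apply: in_span_mem.
(* Taking components of degree [d] in the expansion of [x] over [S] kills the term of [p], whose
   degree exceeds [r] and hence [d]. *)
rewrite -(pihomog_dE hx) xE linear_sum /= (big_rem p) //=.
rewrite (pihomogM _ _ hp) leqNgt (leq_ltn_trans ledr ltr) /= add0r.
apply: in_span_sum => y yS; have [e hy] := hS y (mem_rem yS).
rewrite (pihomogM _ _ hy); case: ifP => _; last exact: in_span0.
by apply/in_spanM/in_span_mem; rewrite ?rem_uniq.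
Qed.

(** [omega] is picked by [epsilon], so it has the intended property as soon as some value does; a
    minimal system extracted from a finite homogeneous one provides that value. *)
Lemma omega_spec (I : {pred {mpoly K[N]}}) :
  (exists S, [/\ uniq S, forall p, p \in S -> exists d, p \is d.-homog &
     generates S I]) -> is_omega I (omega I).
Proof.
move=> [S [uS hS gS]]; rewrite /omega; apply: epsilon_spec.
case: (excluded_middle_informative (forall p, p \in I -> p = 0)) => H.
  by exists 2%N; left.
have [S' mS'] := minimal_generators_exists uS hS gS.
by exists (\max_(p <- S') (msize p).-1)%N; right; split=> //; exists S'.
Qed.

End Span.

(** * Linear forms on polynomials prescribed on monomials *)

Section LinearFunctional.
Variables (K : fieldType) (n : nat).
Implicit Types (h : 'X_{1..n} -> K) (p q : {mpoly K[n]}).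

Definition mfun h p : K := \sum_(m <- msupp p) p@_m * h m.

(** Supports vary with the polynomial; all monomials of bounded degree form a common index set, on
    which linearity can be checked termwise. *)
Lemma mfunwE h k p : (msize p <= k)%N ->
  mfun h p = \sum_(m : 'X_{1..n < k}) p@_m * h m.
Proof.
move=> lt_pk; pose I : subFinType _ := 'X_{1..n < k}.
rewrite /mfun (ssrcomplements.big_mksub I) //=; first last.
- by move=> x /msize_mdeg_lt /leq_trans; apply.
- by rewrite msupp_uniq.
by rewrite big_rmcond //= => i; move/memN_msupp_eq0 ->; rewrite mul0r.
Qed.

Lemma mfun_is_linear h : scalar (mfun h).
Proof.
move=> c p q.
pose k := maxn (msize (c *: p + q)) (maxn (msize p) (msize q)).
rewrite !(@mfunwE _ k) ?leq_max ?leqnn ?orbT //.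
rewrite mulr_sumr -big_split; apply: eq_bigr => m _ /=.
by rewrite mcoeffD mcoeffZ mulrDl mulrA.
Qed.

HB.instance Definition _ h :=
  GRing.isLinear.Build K {mpoly K[n]} K _ (mfun h) (mfun_is_linear h).

Lemma mfunX h m : mfun h 'X_[m] = h m.
Proof. by rewrite /mfun msuppX big_seq1 mcoeffX eqxx mul1r. Qed.

End LinearFunctional.

(** * Toric ideals and their binomials *)

Section Toric.
Variables (K : fieldType) (n N : nat) (a : 'I_N -> 'X_{1..n}).
Implicit Types (u v w m : 'X_{1..N}) (p q : {mpoly K[N]}).

Local Notation toric_map p := (p \mPo [tuple toric_monomial K a i | i < N]).

(** Exponent of the image of ['X_[m]]: the first [n] coordinates are the sum of the points [a i]
    weighted by [m], the last one is the degree. *)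
Definition toric_exp m : 'X_{1..n + 1} :=
  (\sum_(i < N) (\sum_(j < n) U_(lshift 1 j) *+ a i j + U_(rshift n ord0)) *+ m i)%MM.

Lemma toric_mapX m : toric_map 'X_[K, m] = 'X_[toric_exp m].
Proof.
pose X_sum k := big_morph (@mpolyX k K) (@mpolyXD k K) (mpolyX0 k K).
rewrite comp_mpolyX /toric_exp X_sum; apply: eq_bigr => i _.
rewrite tnth_mktuple -mpolyXn mpolyXD X_sum; congr ((_ * _) ^+ _).
by apply: eq_bigr => j _; rewrite mpolyXn.
Qed.

Lemma toric_exp_lshift m (j : 'I_n) :
  toric_exp m (lshift 1 j) = (\sum_(i < N) a i j * m i)%N.
Proof.
rewrite mnm_sumE; apply: eq_bigr => i _.
rewrite mulmnE mnmDE mnm_sumE (bigD1 j) //= big1 => [|k kj].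
  by rewrite mulmnE !mnm1E eqxx eq_rlshift mul1n !addn0.
by rewrite mulmnE mnm1E (inj_eq (@lshift_inj _ _)) (negbTE kj).
Qed.

Lemma toric_exp_rshift m : toric_exp m (rshift n ord0) = mdeg m.
Proof.
rewrite mnm_sumE mdegE; apply: eq_bigr => i _.
rewrite mulmnE mnmDE mnm_sumE big1 => [|k kj].
  by rewrite mnm1E eqxx mul1n.
by rewrite mulmnE mnm1E eq_lrshift.
Qed.

Lemma toric_expP u v :
  toric_exp u = toric_exp v <->
  mdeg u = mdeg v /\
  forall j, (\sum_(i < N) a i j * u i = \sum_(i < N) a i j * v i)%N.
Proof.
split=> [uv|[duv suv]].
  by split=> [|j]; rewrite -?toric_exp_rshift -?toric_exp_lshift uv.
apply/mnmP => x; case: (split_ordP x) => [j ->|o ->].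
  by rewrite !toric_exp_lshift.
by rewrite ord1 !toric_exp_rshift.
Qed.

Lemma toric_exp_mdeg u v : toric_exp u = toric_exp v -> mdeg u = mdeg v.
Proof. by case/toric_expP. Qed.

Lemma toric_expD u v : toric_exp (u + v) = (toric_exp u + toric_exp v)%MM.
Proof.
rewrite /toric_exp -big_split; apply: eq_bigr => i _.
by apply/mnmP => x; rewrite !(mnmDE, mulmnE) mulnDr.
Qed.

Lemma toric_exp_add2l w u v :
  toric_exp (w + u) = toric_exp (w + v) <-> toric_exp u = toric_exp v.
Proof. by rewrite !toric_expD; split=> [/addmI|->]. Qed.

Lemma toric_idealE p : (p \in toric_ideal K a) = (toric_map p == 0).
Proof. by []. Qed.

Lemma toric_ideal_binomial u v : toric_exp u = toric_exp v ->
  'X_[u] - 'X_[v] \in toric_ideal K a.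
Proof.
by move=> uv; rewrite toric_idealE linearB /= !toric_mapX uv subrr.
Qed.

Lemma toric_ideal_span S p : (forall q, q \in S -> q \in toric_ideal K a) ->
  in_span S p -> p \in toric_ideal K a.
Proof.
move=> SI [c ->]; rewrite toric_idealE linear_sum /= big_seq big1 // => q qS.
by rewrite rmorphM /= (eqP (SI q qS)) mulr0.
Qed.

Lemma toric_mapE p :
  toric_map p = \sum_(m <- msupp p) p@_m *: 'X_[toric_exp m].
Proof. by rewrite comp_mpolyEX; apply: eq_bigr => m _; rewrite toric_mapX. Qed.

(** In an element of the ideal the coefficients over each fibre of [toric_exp] cancel, so any [u] in
    the support shares its fibre with another [v] in the support. Subtracting a multiple of ['X_[u]
    - 'X_[v]] then shrinks the support. *)
Lemma toric_ideal_binomials S :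
    (forall u v, toric_exp u = toric_exp v -> in_span S ('X_[u] - 'X_[v])) ->
  forall p, p \in toric_ideal K a -> in_span S p.
Proof.
move=> SB p; elim: {p}(size (msupp p)).+1 {-2}p (ltnSn (size (msupp p))) =>
  // l IH p.
rewrite ltnS => lep pI.
have [->|p0] := eqVneq p 0; first exact: in_span0.
have [u up] : exists u, u \in msupp p.
  by exists (mlead p); apply: mlead_supp.
have [v vp /andP[vu /eqP Evu]] :
    exists2 v, v \in msupp p & (v != u) && (toric_exp v == toric_exp u).
  apply/hasP; apply: contraT => /hasPn nE.
  have /eqP/(congr1 (mcoeff (toric_exp u))) := pI.
  rewrite toric_mapE mcoeff0 (big_rem u) //= mcoeffD linear_sum /= big_seq big1.
    rewrite addr0 mcoeffZ mcoeffX eqxx mulr1 => pu0.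
    by move: up; rewrite mcoeff_msupp pu0 eqxx.
  move=> v; rewrite mem_rem_uniq ?msupp_uniq // inE => /andP[vu /nE].
  by rewrite vu mcoeffZ mcoeffX /= => /negbTE->; rewrite mulr0.
rewrite -[p](subrK (p@_u *: ('X_[u] - 'X_[v]))).
apply: in_spanD; last by rewrite -mul_mpolyC; apply/in_spanM/SB.
apply: IH; last first.
  rewrite toric_idealE linearB /= linearZ /= (eqP pI).
  by rewrite (eqP (toric_ideal_binomial (esym Evu))) scaler0 subr0.
(* The new support lies in that of [p] without [u]: the coefficient at [u] cancels and [v] was
   already present. *)
apply: leq_trans lep; rewrite (perm_size (perm_to_rem up)) /= ltnS.
apply: uniq_leq_size; first exact: msupp_uniq.
move=> m; rewrite mem_rem_uniq ?msupp_uniq // inE mcoeff_msupp.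
rewrite mcoeffB mcoeffZ mcoeffB !mcoeffX => mne.
have mu : m != u.
  by apply: contra_neq mne => ->; rewrite eqxx (negbTE vu) subr0 mulr1 subrr.
rewrite mu /=; have [<-//|vm] := eqVneq v m.
by move: mne; rewrite mcoeff_msupp [u == m]eq_sym (negbTE mu) (negbTE vm) subrr mulr0 subr0.
Qed.

(* By Dickson's lemma only finitely many binomials of the ideal are minimal for
   the componentwise order on the pair of exponents (the Graver basis). *)
Lemma toric_ideal_fin_gen :
  exists S, [/\ uniq S, forall p, p \in S -> exists d, p \is d.-homog &
    generates S (toric_ideal K a)].
Proof.
pose fs : seq ('X_{1..N} * 'X_{1..N} -> nat) :=
  [seq (fun x : 'X_{1..N} * 'X_{1..N} => x.1 i) | i <- enum 'I_N] ++
  [seq (fun x : 'X_{1..N} * 'X_{1..N} => x.2 i) | i <- enum 'I_N].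
pose P (x : 'X_{1..N} * 'X_{1..N}) := toric_exp x.1 =
  toric_exp x.2 /\ x.1 <> x.2.
have [B [BP Bmin]] := dickson fs P.
pose S := undup [seq 'X_[K, x.1] - 'X_[x.2] | x <- B].
have uS : uniq S by apply: undup_uniq.
have SI q : q \in S -> q \in toric_ideal K a.
  rewrite mem_undup => /mapP[x /BP[xE _] ->]; exact: toric_ideal_binomial.
exists S; split=> // [p|p].
  rewrite mem_undup => /mapP[x /BP[/toric_exp_mdeg xE _] ->].
  by exists (mdeg x.1); rewrite rpredB // dhomogX //= xE.
split; last by move=> /(toric_ideal_span SI).
apply: toric_ideal_binomials => {p} u v.
elim: {u}(mdeg u).+1 {-2}u v (ltnSn (mdeg u)) => // l IH u v.
rewrite ltnS => leul uv.
have [->|/eqP neuv] := eqVneq u v; first by rewrite subrr; apply: in_span0.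
have [[u' v'] b0 le0] := Bmin (u, v) (conj uv neuv).
have [/= E0 ne0] := BP _ b0.
move: le0; rewrite all_cat => /andP[]; rewrite all_map => leu0;
  rewrite all_map => lev0.
have en (i : 'I_N) : i \in enum 'I_N by rewrite mem_enum.
have leu : (u' <= u)%MM.
  by apply/mnm_lepP => i; exact: (allP leu0 i (en i)).
have lev : (v' <= v)%MM.
  by apply/mnm_lepP => i; exact: (allP lev0 i (en i)).
have Eu := submK leu; have Ev := submK lev.
(* The binomial splits into ['X_[u - u']] times the basis binomial of [(u', v')], plus ['X_[v']]
   times the binomial of [(u - u', v - v')], which has smaller degree. *)
rewrite -(subrK 'X_[u - u' + v'] 'X_[u]) -addrA; apply: in_spanD.
  rewrite -[in X in X - _]Eu !mpolyXD -mulrBr; apply/in_spanM/in_span_mem => //.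
  by rewrite mem_undup; apply/mapP; exists (u', v').
rewrite -[in X in _ - X]Ev !mpolyXD -mulrBl mulrC.
apply/in_spanM/IH; last first.
  apply/(toric_exp_add2l v'); rewrite ![(v' + _)%MM]addmC Ev.
  by rewrite -uv -[in RHS]Eu !toric_expD E0.
apply: leq_trans leul; rewrite -[in X in (_ < X)%N]Eu mdegD -addn1 leq_add2l.
(* If [u'] were 0, then [v'], having the same degree, would be 0 too, against [u' <> v']. *)
rewrite lt0n mdeg_eq0; apply/eqP => u'0; apply: ne0; rewrite u'0.
by apply/esym/eqP; rewrite -mdeg_eq0 -(toric_exp_mdeg E0) u'0 mdeg0.
Qed.

(** * Degree bounds on generators and connectivity of fibres *)

Section Connectivity.
Variable r : nat.

Definition mstep u v : Prop :=
  exists w x y, [/\ u = (w + x)%MM, v = (w + y)%MM,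
    toric_exp x = toric_exp y & (mdeg x <= r)%N].

Definition mconn := clos_refl_trans _ mstep.

Lemma mconn_sym u v : mconn u v -> mconn v u.
Proof.
elim=> [x y [w [s [t [-> -> st dr]]]]|x|x y z _ xy _ yz].
- by apply: rt_step; exists w, t, s; rewrite -(toric_exp_mdeg st).
- exact: rt_refl.
- exact: rt_trans yz xy.
Qed.

(** The degree bound makes the exponents a finite type, so all these binomials can be listed;
    [undup] provides the uniqueness that spans require. *)
Definition small_binomials : seq {mpoly K[N]} :=
  undup [seq ('X_[x.1] - 'X_[x.2] : {mpoly K[N]}) |
    x : 'X_{1..N < r.+1} * 'X_{1..N < r.+1} in 
      [pred x : 'X_{1..N < r.+1} * 'X_{1..N < r.+1} | toric_exp x.1 == toric_exp x.2]].

Lemma mem_small_binomials x y : toric_exp x = toric_exp y -> (mdeg x <= r)%N ->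
  'X_[x] - 'X_[y] \in small_binomials.
Proof.
move=> xy dx; have dy : (mdeg y <= r)%N by rewrite -(toric_exp_mdeg xy).
rewrite mem_undup; apply/imageP.
by exists (@BMultinom N r.+1 x dx, @BMultinom N r.+1 y dy) => //=; apply/eqP.
Qed.

Lemma small_binomialsP p : p \in small_binomials ->
  exists x y, [/\ p = 'X_[x] - 'X_[y], toric_exp x =
    toric_exp y & (mdeg x <= r)%N].
Proof.
rewrite mem_undup => /imageP[[x y] /eqP xy ->]; exists x, y; split=> //.
exact: (bmdeg x).
Qed.

Lemma mconn_small_binomials u v : mconn u v ->
  in_span small_binomials ('X_[u] - 'X_[v]).
Proof.
elim=> [x y [w [s [t [-> -> st dr]]]]|x|x y z _ xy _ yz].
- rewrite !mpolyXD -mulrBr; apply/in_spanM/in_span_mem; first exact: undup_uniq.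
  exact: mem_small_binomials.
- by rewrite subrr; apply: in_span0.
- by rewrite -(subrK 'X_[y] 'X_[x]) -addrA; apply: in_spanD.
Qed.

Definition mconn_indic u m : K :=
  if excluded_middle_informative (mconn m u) then 1 else 0.

(* Multiplying by a monomial [w], the condition that [w + m] is connected to [u]
   depends only on the fibre of [m] when [m] has degree at most [r]; on each
   fibre the coefficients of an element of the ideal add up to 0. *)
Lemma mfun_mconn_indic u p q : q \in toric_ideal K a ->
  (forall m, m \in msupp q -> (mdeg m <= r)%N) ->
  mfun (mconn_indic u) (p * q) = 0.
Proof.
move=> qI qr.
rewrite [p]mpolyE mulr_suml linear_sum /= big1 // => w _.
rewrite -scalerAl linearZ /=.
pose H t : K := if excluded_middle_informative (exists m,
  [/\ toric_exp m = t, (mdeg m <= r)%N & mconn (w + m)%MM u]) then 1 else 0.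
suff -> : mfun (mconn_indic u) ('X_[w] * q) = mfun H (toric_map q).
  by rewrite (eqP qI) linear0 mulr0.
rewrite toric_mapE [q in LHS]mpolyE mulr_sumr !linear_sum /=.
apply: eq_big_seq => m mq; rewrite -scalerAr !linearZ /= -mpolyXD !mfunX.
congr (_ * _); rewrite /H /mconn_indic.
case: excluded_middle_informative => c1;
  case: excluded_middle_informative => c2 //.
  by case: c2; exists m; split=> //; apply: qr.
(* Two exponents of degree at most [r] in one fibre are exchanged by a single step after adding
   [w]. *)
case: c1; case: c2 => m' [mm' dm' cm']; apply: rt_trans cm'.
by apply: rt_step; exists w, m, m'; split=> //; apply: qr.
Qed.

Lemma generated_connected S : generates S (toric_ideal K a) ->
    (forall q, q \in S -> q \in toric_ideal K a) ->
    (forall q m, q \in S -> m \in msupp q -> (mdeg m <= r)%N) ->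
  forall u v, toric_exp u = toric_exp v -> mconn u v.
Proof.
move=> gS SI Sr u v uv; apply: mconn_sym.
have [c cE] := (gS _).1 (toric_ideal_binomial uv).
have : mfun (mconn_indic u) ('X_[u] - 'X_[v]) = 0.
  rewrite cE linear_sum /= big_seq big1 // => q qS.
  by apply: mfun_mconn_indic => [|m]; [apply: SI | apply: Sr].
rewrite linearB /= !mfunX /mconn_indic.
case: excluded_middle_informative => c1; last by case: c1; apply: rt_refl.
case: excluded_middle_informative => [//|c2]; rewrite subr0 => /eqP.
by rewrite oner_eq0.
Qed.

Lemma omega_toric_ideal_le : (2 <= r)%N ->
  (omega (toric_ideal K a) <= r)%N <->
  (forall u v, toric_exp u = toric_exp v -> mconn u v).
Proof.
move=> r2; have := omega_spec toric_ideal_fin_gen.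
set w := omega _ => -[[I0 ->]|[_ [S mS ->]]].
  (* For the zero ideal the bound is the convention 2, and the empty list of generators already
     forces connectivity. *)
  split=> // _; apply: (@generated_connected [::]) => // p.
  split=> [/I0->|[c ->]]; first exact: in_span0.
  by rewrite big_nil toric_idealE linear0.
have [uS _ gS _] := mS; split=> [ler|conn].
  have Sr q : q \in S -> ((msize q).-1 <= r)%N.
    by move=> qS; apply: leq_trans ler; apply: leq_bigmax_seq.
  apply: (generated_connected gS) => [q qS|q m qS /msize_mdeg_lt lt].
    by apply/gS/in_span_mem.
  by apply: leq_trans (Sr q qS); rewrite -ltnS (ltn_predK lt).
(* Connectivity makes the small binomials generate, and graded Nakayama transfers their degree bound
   to the minimal system [S]. *)
apply/bigmax_leqP_seq => p pS _.
apply: (@minimal_generators_deg _ _ _ small_binomials _ _ mS) pS; last 2 first.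
- exact: undup_uniq.
- move=> q /small_binomialsP[x [y [-> xy dx]]]; exists (mdeg x) => //.
  by rewrite rpredB // dhomogX //= (toric_exp_mdeg xy).
move=> p'; split; last first.
  apply: toric_ideal_span => q /small_binomialsP[x [y [-> xy _]]].
  exact: toric_ideal_binomial.
by apply: toric_ideal_binomials => u v uv; apply/mconn_small_binomials/conn.
Qed.

End Connectivity.
End Toric.

(** * Recoloring edge-replication multigraphs *)

(** Transpositions pair the elements of [A :\: B] with those of [B :\: A]. Fixing all other points
    is what later leaves unaffected color classes untouched. *)
Lemma perm_imset_eq_card (C : finType) (A B : {set C}) : #|A| = #|B| ->
  exists s : {perm C}, s @: A = B /\ forall x, (x \in A) = (x \in B) -> s x = x.
Proof.
elim: {A}#|A :\: B|.+1 {-2}A (ltnSn #|A :\: B|) => // m IH A;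
  rewrite ltnS => le AB.
have cD : #|A :\: B| = #|B :\: A| by rewrite !cardsD AB setIC.
have [D0|[x]] := set_0Vmem (A :\: B).
  exists 1%g; split=> [|x _]; last by rewrite perm1.
  have sAB : A \subset B by rewrite -setD_eq0 D0.
  rewrite (eq_imset A (@perm1 _)) imset_id; apply/eqP.
  by rewrite eqEcard sAB AB leqnn.
move=> xD; have [D0|[y yD]] := set_0Vmem (B :\: A).
  by move: cD; rewrite D0 cards0 => /eqP; rewrite cards_eq0 => /eqP D1;
    rewrite D1 inE in xD.
have [xNB xA] : x \notin B /\ x \in A by move: xD; rewrite inE => /andP[].
have [yNA yB] : y \notin A /\ y \in B by move: yD; rewrite inE => /andP[].
pose A1 := tperm x y @: A.
have mem1 z : z \in A1 = (tperm x y z \in A).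
  by rewrite -[z in LHS](tpermK x y) (mem_imset _ _ (@perm_inj _ (tperm x y))).
have [||s [sA sfix]] := IH A1.
- apply: leq_trans le; apply: proper_card; apply/properP; split.
    apply/subsetP => z; rewrite !inE mem1 => /andP[zB].
    by case: tpermP zB => [->|->|_ _ ->] //; rewrite ?yB // (negbTE yNA).
  by exists x; rewrite // !inE mem1 tpermL (negbTE yNA) andbF.
- by rewrite card_imset //; apply: perm_inj.
exists (tperm x y * s)%g; split.
  by rewrite -sA -imset_comp; apply: eq_imset => z; rewrite permM.
move=> z zAB; rewrite permM.
have zxy : tperm x y z = z.
  case: tpermP zAB => // ->; first by rewrite xA (negbTE xNB).
  by rewrite yB (negbTE yNA).
by rewrite zxy; apply: sfix; rewrite mem1 zxy.
Qed.

Section Colorings.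
Variables (V : finType) (n : nat) (e : 'I_n -> {set V}) (k : nat).
Hypothesis e_neq0 : forall j, e j != set0.

Definition disjoint_edges (M : {set 'I_n}) : Prop :=
  forall i j, i \in M -> j \in M -> i != j -> [disjoint e i & e j].

Section FixedMultiplicities.
Variable b : 'I_n -> nat.
Local Notation coloring := (edge_coloring (replicated_ends e b) k).
Local Notation copy i := (@Tagged _ _ (fun j => 'I_(b j)) i).
Implicit Types (f g : coloring) (M : 'I_k -> {set 'I_n}).

Lemma coloringP (h : {ffun replicated_edge b -> 'I_k}) :
  reflect (forall x y, x != y -> ~~ [disjoint e (tag x) & e (tag y)] ->
    h x != h y)
    (proper_coloring (replicated_ends e b) h).
Proof.
apply: (iffP forallP) => [H x y xy xym|H x].
  by have /forallP/(_ y)/implyP := H x; apply; rewrite xy.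
by apply/forallP => y; apply/implyP => /andP[]; apply: H.
Qed.

(** Parallel copies meet because edges are nonempty, so a proper coloring separates them. *)
Lemma coloring_inj f x y : tag x = tag y -> val f x = val f y -> x = y.
Proof.
move=> xy fxy; apply: contraTeq isT => nxy.
have /coloringP/(_ x y nxy) := valP f.
by rewrite -setI_eq0 xy setIid => /(_ (e_neq0 _)); rewrite fxy eqxx.
Qed.

Lemma color_step_card r f g :
  color_step r f g = (#|[set c | color_class f c != color_class g c]| <= r)%N.
Proof.
apply/existsP/idP => [[m /existsP[S /andP[/eqP cS /forallP SP]]]|le].
  have -> : [set c | color_class f c != color_class g c] = S.
    by apply/setP => c; rewrite inE; apply/esym/eqP/SP.
  by rewrite cS -ltnS ltn_ord.
exists (Ordinal (le : (_ < r.+1)%N)); apply/existsP.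
exists [set c | color_class f c != color_class g c]; rewrite eqxx /=.
by apply/forallP => c; rewrite inE.
Qed.

(** The color class with the identity of parallel copies forgotten: a matching of the underlying
    graph. *)
Definition footprint f (c : 'I_k) : {set 'I_n} := [set tag x | x in color_class f c].

Lemma footprintP f c j :
  reflect (exists2 x, tag x = j & val f x = c) (j \in footprint f c).
Proof.
apply: (iffP imsetP) => [[x xc ->]|[x <- <-]]; exists x => //.
  by move: xc; rewrite inE => /eqP.
by rewrite inE.
Qed.

Lemma footprint_disjoint f c : disjoint_edges (footprint f c).
Proof.
move=> i j /footprintP[x <- fx] /footprintP[y <- fy] xy.
have /coloringP/(_ x y) := valP f; rewrite fx fy eqxx.
have -> : x != y by apply: contraNneq xy => ->.
by case: [disjoint _ & _] => // /(_ isT isT).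
Qed.

Lemma card_footprint f j : #|[set c | j \in footprint f c]| = b j.
Proof.
have -> : [set c | j \in footprint f c] =
          [set val f (copy i) | i : 'I_(b j)].
  apply/setP => c; rewrite inE; apply/footprintP/imsetP.
    by case=> [[j' i] /= jj' <-]; subst j'; exists i.
  by case=> i _ ->; exists (copy i).
rewrite card_imset ?card_ord // => i i' fii'.
have /eqP := @coloring_inj f (copy i) (copy i') erefl fii'.
by rewrite eq_Tagged => /eqP.
Qed.

(** The colorings differ by permutations of parallel copies. Swapping [x] with the copy [y] that has
    the color wanted at [x] changes at most two classes and corrects [x]; here [2 <= r] is used. *)
Lemma color_equiv_footprint r f g : (2 <= r)%N ->
  footprint f =1 footprint g -> color_equiv r f g.
Proof.
move=> r2.
elim: {f}#|[set x | val f x != val g x]|.+1 {-2}f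
  (ltnSn #|[set x | val f x != val g x]|) => // m IH f; rewrite ltnS => le fg.
have [D0|[x]] := set_0Vmem [set x | val f x != val g x].
  suff -> : f = g by rewrite /color_equiv connect0.
  apply/val_inj/ffunP => x; apply/eqP/negPn/negP => fgx.
  have : x \in set0 by rewrite -D0 inE.
  by rewrite inE.
rewrite inE => xD.
have [y yx fy] : exists2 y, tag y = tag x & val f y = val g x.
  by apply/footprintP; rewrite fg; apply/footprintP; exists x.
have tagt z : tag (tperm x y z) = tag z.
  by case: tpermP => [-> //|-> //|//].
pose h := [ffun z => val f (tperm x y z)].
have hP : proper_coloring (replicated_ends e b) h.
  apply/coloringP => z t zt; rewrite !ffunE -(tagt z) -(tagt t) => dzt.
  by have /coloringP := valP f; apply; rewrite // (inj_eq (@perm_inj _ _)).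
pose f' : coloring := exist _ h hP.
have cf' c : color_class f' c = tperm x y @: color_class f c.
  apply/setP => z; rewrite !inE ffunE.
  by rewrite -[z in RHS](tpermK x y) (mem_imset _ _ (@perm_inj _ (tperm x y))) inE.
apply: (@connect_trans _ _ f'); last apply: IH.
- apply: connect1; rewrite color_step_card; apply: leq_trans r2.
  apply: leq_trans (_ : #|[set val f x; val f y]| <= _)%N;
    last by rewrite cards2; case: eqP.
  apply: subset_leq_card; apply/subsetP => c; rewrite !inE cf'.
  apply: contraNT; rewrite negb_or => /andP[cx cy]; apply/eqP/setP => z.
  rewrite -[z in RHS](tpermK x y) (mem_imset _ _ (@perm_inj _ (tperm x y))) !inE.
  move: cx cy; rewrite ![c == _]eq_sym => /negbTE cx /negbTE cy.
  by case: tpermP => [->|->|//]; rewrite ?tpermL ?tpermR cx cy.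
- apply: leq_trans le; apply: proper_card; apply/properP; split.
    apply/subsetP => z; rewrite !inE ffunE; case: tpermP => //.
      by move=> ->; rewrite fy eqxx.
    (* The swap spoils nothing at [y], which was already wrong: its color is [val g x], and [g]
       separates the copies [x] and [y]. *)
    move=> -> _; rewrite fy;
      apply: contra_neq xD => /(coloring_inj (esym yx)) xy.
    by rewrite {1}xy.
  by exists x; rewrite !inE ?xD // ffunE tpermL fy eqxx.
- move=> c; rewrite -fg /footprint cf' -imset_comp.
  by apply: eq_imset => z /=.
Qed.

Lemma recolor f M : (forall c, disjoint_edges (M c)) ->
    (forall j, #|[set c | j \in M c]| = b j) ->
  exists2 f', footprint f' =1 M &
    forall c, footprint f c = M c -> color_class f' c = color_class f c.
Proof.
move=> dM cM.
pose C j := [set c | j \in footprint f c]; pose D j := [set c | j \in M c].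
have /fin_all_exists[s sP] (j : 'I_n) : exists s : {perm 'I_k},
    s @: C j = D j /\ forall c, (c \in C j) = (c \in D j) -> s c = c.
  by apply: perm_imset_eq_card; rewrite card_footprint cM.
have sC x : val f x \in C (tag x) by rewrite inE; apply/footprintP; exists x.
pose h := [ffun x => s (tag x) (val f x)].
have hM x : tag x \in M (h x).
  have : h x \in D (tag x); last by rewrite inE.
  by rewrite -(sP _).1 ffunE imset_f.
have hP : proper_coloring (replicated_ends e b) h.
  apply/coloringP => x y xy; apply: contraNneq => hxy.
  have [txy|txy] := eqVneq (tag x) (tag y).
    move: hxy; rewrite !ffunE txy => /perm_inj/(coloring_inj txy).
    by move/eqP; rewrite (negbTE xy).
  by apply: (dM (h x)) => //; rewrite hxy.
exists (exist _ h hP) => [c|c fc].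
  apply/setP => j; apply/footprintP/idP => [[x <- <-]|jM]; first exact: hM.
  have : c \in s j @: C j by rewrite (sP j).1 inE.
  case/imsetP => d; rewrite inE => /footprintP[x <- <-] ->.
  by exists x; rewrite //= ffunE.
apply/setP => x; rewrite !inE ffunE.
have sc : s (tag x) c = c by apply: (sP _).2; rewrite !inE fc.
by rewrite -[c in LHS]sc (inj_eq perm_inj).
Qed.

Lemma recolor_step r f M : (forall c, disjoint_edges (M c)) ->
    (forall j, #|[set c | j \in M c]| = b j) ->
    (#|[set c | footprint f c != M c]| <= r)%N ->
  exists2 f', footprint f' =1 M & color_step r f f'.
Proof.
move=> dM cM ler; have [f' f'M f'f] := recolor f dM cM.
exists f' => //; rewrite color_step_card; apply: leq_trans ler.
apply: subset_leq_card; apply/subsetP => c; rewrite !inE.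
by apply: contra_neq => /f'f ->.
Qed.

(** The footprints agree up to a permutation of colors, which is realized by transpositions, each
    changing at most two classes. *)
Lemma color_equiv_perm r f g : (2 <= r)%N ->
    (forall A, #|[set c | footprint f c == A]| =
      #|[set c | footprint g c == A]|) ->
  color_equiv r f g.
Proof.
move=> r2.
elim: {f}#|[set c | footprint f c != footprint g c]|.+1 {-2}f
  (ltnSn #|[set c | footprint f c != footprint g c]|) => // m IH f;
    rewrite ltnS => le fg.
have [D0|[c]] := set_0Vmem [set c | footprint f c != footprint g c].
  apply: color_equiv_footprint => // c; apply/eqP/negPn/negP => fgc.
  have : c \in set0 by rewrite -D0 inE.
  by rewrite inE.
rewrite inE => cD; pose A := footprint g c.
(* A color carrying [A] in [f] but not in [g]: otherwise, by equality of the counts, [f] and [g]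
   would use the same colors for [A], including [c]. *)
have [d dfA dgA] : exists2 d, footprint f d = A & footprint g d != A.
  have : ~~ ([set c | footprint f c == A] \subset [set c | footprint g c == A]).
    apply/negP => sub; have : c \in [set c | footprint f c == A].
      have/eqP-> : [set c | footprint f c == A] == [set c | footprint g c == A].
        by rewrite eqEcard sub fg leqnn.
      by rewrite inE.
    by rewrite inE (negbTE cD).
  by case/subsetPn => d; rewrite !inE => /eqP dA dgA; exists d.
pose M z := footprint f (tperm c d z).
have countM (P : pred {set 'I_n}) : #|[set z | P (M z)]| =
  #|[set z | P (footprint f z)]|.
  rewrite -[RHS](card_imset _ (@perm_inj _ (tperm c d))); apply: eq_card => z.
  by rewrite -[z in RHS](tpermK c d) (mem_imset _ _ (@perm_inj _ (tperm c d))) !inE.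
have [|||f' f'M ff'] := @recolor_step r f M.
- by move=> z; apply: footprint_disjoint.
- by move=> j; rewrite (countM (fun B : {set _} => j \in B)) card_footprint.
- apply: leq_trans r2; apply: leq_trans (_ : #|[set c; d]| <= _)%N;
    last by rewrite cards2; case: eqP.
  apply: subset_leq_card; apply/subsetP => z; rewrite !inE /M.
  by apply: contraNT; case: tpermP => [->|->|//]; rewrite eqxx ?orbT.
apply: (connect_trans (connect1 ff')); apply: IH => [|B]; last first.
  by rewrite -fg -(countM (pred1 B)); apply: eq_card => z; rewrite !inE f'M.
apply: leq_trans le; apply: proper_card; apply/properP; split.
  apply/subsetP => z; rewrite !inE f'M /M; case: tpermP => [->|->|//].
    by rewrite dfA eqxx.
  by move=> _; rewrite dfA eq_sym.
by exists c; rewrite !inE ?cD // f'M /M tpermL dfA eqxx.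
Qed.

End FixedMultiplicities.

(** The copies of [j] are numbered by the colors [c] with [j] in [M c], and each copy takes the
    color that numbers it. *)
Lemma coloring_exists (M : 'I_k ->
  {set 'I_n}) : (forall c, disjoint_edges (M c)) ->
  exists f : edge_coloring
    (replicated_ends e (fun j => #|[set c | j \in M c]|)) k, footprint f =1 M.
Proof.
move=> dM; pose b j := #|[set c | j \in M c]|.
pose h := [ffun x : replicated_edge b => enum_val (tagged x : 'I_(b (tag x)))].
have hM x : tag x \in M (h x).
  by rewrite ffunE; have := enum_valP (tagged x : 'I_(b (tag x))); rewrite inE.
have hP : proper_coloring (replicated_ends e b) h.
  apply/coloringP => x y xy; apply: contraNneq => hxy.
  have [txy|txy] := eqVneq (tag x) (tag y); last first.
    by apply: (dM (h x)) => //; rewrite hxy.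
  case/eqP: xy; case: x y txy hxy {hM} => [j i] [j' i'] /= jj'; subst j'.
  by rewrite !ffunE /= => /enum_val_inj ->.
exists (exist _ h hP) => c; apply/setP => j.
apply/footprintP/idP => [[x <- <-]|jM]; first exact: hM.
have cj : c \in [set c | j \in M c] by rewrite inE.
exists (@Tagged _ j (fun j => 'I_(b j)) (enum_rank_in cj c)) => //=.
by rewrite ffunE /= enum_rankK_in.
Qed.

End Colorings.

(** * Monomials as unordered tuples of variables *)

Section TupleMonomial.
Variables (N k : nat).
Implicit Types (T : 'I_k -> 'I_N).

Definition tuple_mnm T : 'X_{1..N} := (\sum_(c < k) U_(T c))%MM.

Lemma mdeg_tuple_mnm T : mdeg (tuple_mnm T) = k.
Proof.
rewrite /tuple_mnm mdeg_sum; under eq_bigr do rewrite mdeg1.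
by rewrite sum1_card card_ord.
Qed.

Lemma card_tuple_mnm T (P : pred 'I_N) :
  #|[set c | P (T c)]| = (\sum_(i | P i) tuple_mnm T i)%N.
Proof.
under eq_bigr do rewrite mnm_sumE.
rewrite exchange_big /= -sum1dep_card big_mkcond; apply: eq_bigr => c _.
under eq_bigr do rewrite mnm1E.
case: ifP => PT.
  by rewrite (bigD1 (T c)) //= eqxx big1 // => i /andP[_];
    rewrite eq_sym => /negbTE->.
by rewrite big1 // => i Pi; case: eqP => // Ti; rewrite Ti Pi in PT.
Qed.

Lemma tuple_mnm_nth i0 s : size s = k ->
  tuple_mnm (fun c => nth i0 s c) = (\sum_(i <- s) U_(i))%MM.
Proof. by move=> sk; rewrite (big_nth i0) sk big_mkord. Qed.

End TupleMonomial.

Lemma mnm_seq N (m : 'X_{1..N}) :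
  exists2 s : seq 'I_N, size s = mdeg m & m = (\sum_(i <- s) U_(i))%MM.
Proof.
have [s mE] : exists s : seq 'I_N, m = (\sum_(i <- s) U_(i))%MM.
  exists (flatten [seq nseq (m i) i | i <- enum 'I_N]).
  rewrite big_flatten big_map big_enum [LHS]multinomUE_id;
    apply: eq_bigr => i _.
  by elim: (m i) => [|l IH]; rewrite ?big_nil ?big_cons //= mulmS IH.
exists s => //; rewrite mE mdeg_sum; under eq_bigr do rewrite mdeg1.
by rewrite sum1_size.
Qed.

Lemma card_ord_lt k m : (#|[set c : 'I_k | (c < m)%N]| <= m)%N.
Proof.
rewrite cardE -(size_map val) -[X in (_ <= X)%N](size_iota 0).
apply: uniq_leq_size; first by rewrite (map_inj_uniq val_inj) enum_uniq.
by move=> i /mapP[c]; rewrite mem_enum inE mem_iota => cm ->.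
Qed.

(** * Correspondence between colorings and monomials in the matchings *)

Section Bridge.
Variables (V : finType) (n : nat) (e : 'I_n -> {set V}).
Variables (N : nat) (a : 'I_N -> 'X_{1..n}) (A : 'I_N -> {set 'I_n}).
Hypotheses (e_neq0 : forall j, e j != set0)
  (aE : forall i j, a i j = (j \in A i) :> nat)
  (A_inj : injective A)
  (A_disj : forall i, disjoint_edges e (A i))
  (A_all : forall M, disjoint_edges e M -> exists i, M = A i).

(** The exponent of t_j counts the colors whose matching contains edge [j], and both degrees are
    [k]. *)
Lemma toric_exp_tuple k (T T' : 'I_k -> 'I_N) :
  toric_exp a (tuple_mnm T) = toric_exp a (tuple_mnm T') <->
  forall j, #|[set c | j \in A (T c)]| = #|[set c | j \in A (T' c)]|.
Proof.
have E (U : 'I_k -> 'I_N) j :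
    (\sum_(i < N) a i j * tuple_mnm U i)%N = #|[set c | j \in A (U c)]|.
  rewrite (card_tuple_mnm U (fun i => j \in A i)) [RHS]big_mkcond;
    apply: eq_bigr => i _.
  by rewrite aE; case: (_ \in _); rewrite ?mul1n.
split=> [/toric_expP[_ H] j|H]; first by rewrite -!E.
by apply/toric_expP; rewrite !mdeg_tuple_mnm; split=> // j; rewrite !E.
Qed.

Lemma footprint_index b k (f : edge_coloring (replicated_ends e b) k) :
  exists T : 'I_k -> 'I_N, footprint f =1 A \o T.
Proof.
by apply: (fin_all_exists (P := fun c i => footprint f c = A i)) => c;
  apply/A_all/footprint_disjoint.
Qed.

Lemma color_equiv_tuple_mnm b k r (f g : edge_coloring (replicated_ends e b) k)
    (T T' : 'I_k -> 'I_N) : (2 <= r)%N ->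
    footprint f =1 A \o T -> footprint g =1 A \o T' ->
    tuple_mnm T = tuple_mnm T' ->
  color_equiv r f g.
Proof.
move=> r2 fT gT' TT'; apply: color_equiv_perm => // B.
have cB (h : edge_coloring (replicated_ends e b) k) U : footprint h =1 A \o U ->
    #|[set c | footprint h c == B]| = (\sum_(i | A i == B) tuple_mnm U i)%N.
  rewrite -(card_tuple_mnm U (fun i => A i == B)) => hU.
  by apply: eq_card => c; rewrite !inE hU.
by rewrite (cB f T) // (cB g T') // TT'.
Qed.

(** Colors are first permuted so that the factor to be replaced occupies the initial ones; then only
    those, at most [r], are recolored. *)
Lemma mstep_color_equiv b k r (f : edge_coloring (replicated_ends e b) k)
    (T : 'I_k -> 'I_N) v : (2 <= r)%N ->
    footprint f =1 A \o T -> mstep a r (tuple_mnm T) v ->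
  exists f' (T' : 'I_k -> 'I_N),
    [/\ footprint f' =1 A \o T', tuple_mnm T' = v & color_equiv r f f'].
Proof.
move=> r2 fT [w [x [y [TE vE xy dx]]]].
have [i0 _] : exists i, set0 = A i.
  by apply: A_all => i j; rewrite inE.
have [sw sw_size wE] := mnm_seq w; have [sx sx_size xE] := mnm_seq x.
have [sy sy_size yE] := mnm_seq y; have dxy := toric_exp_mdeg xy.
have kE : (mdeg x + mdeg w = k)%N by rewrite addnC -mdegD -TE mdeg_tuple_mnm.
(* With the common factor [w] listed last, [T1] and [T2] agree from position [mdeg x] on; [i0], the
   index of the empty matching, is only a default for [nth]. *)
pose T1 (c : 'I_k) := nth i0 (sx ++ sw) c.
pose T2 (c : 'I_k) := nth i0 (sy ++ sw) c.
have T1E : tuple_mnm T1 = tuple_mnm T.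
  rewrite tuple_mnm_nth ?size_cat ?sx_size ?sw_size // big_cat -wE -xE TE.
  by rewrite /= addmC.
have T2E : tuple_mnm T2 = v.
  rewrite tuple_mnm_nth ?size_cat ?sy_size ?sw_size -?dxy // big_cat -wE -yE vE.
  by rewrite /= addmC.
have T12 : toric_exp a (tuple_mnm T1) = toric_exp a (tuple_mnm T2).
  by rewrite T1E T2E TE vE; apply/toric_exp_add2l.
have cT j : #|[set c | j \in A (T c)]| = b j.
  by rewrite -(card_footprint e_neq0 f); apply: eq_card => c; rewrite !inE fT.
have cT1 j : #|[set c | j \in A (T1 c)]| = b j.
  by rewrite -cT; move: j; apply/toric_exp_tuple; rewrite T1E.
have cT2 j : #|[set c | j \in A (T2 c)]| = b j.
  by rewrite -cT1; move: j; apply/toric_exp_tuple.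
have [f1 f1T1 _] := recolor e_neq0 f (fun c => @A_disj (T1 c)) cT1.
have [|f2 f2T2 f12] := @recolor_step _ _ _ _ e_neq0 _ r f1 _ (fun c =>
  @A_disj (T2 c)) cT2.
  apply: leq_trans dx; apply: leq_trans (card_ord_lt k (mdeg x)).
  apply: subset_leq_card; apply/subsetP => c; rewrite !inE f1T1 /=.
  apply: contraNT; rewrite -leqNgt => xc; rewrite /T1 /T2 !nth_cat.
  by rewrite sx_size sy_size -dxy ltnNge xc.
exists f2, T2; split=> //; apply: connect_trans (connect1 f12).
exact: (color_equiv_tuple_mnm r2 fT f1T1 (esym T1E)).
Qed.

Lemma mconn_color_equiv b k r (f : edge_coloring (replicated_ends e b) k)
    (T : 'I_k -> 'I_N) v : (2 <= r)%N ->
    footprint f =1 A \o T -> mconn a r (tuple_mnm T) v ->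
  exists f' (T' : 'I_k -> 'I_N),
    [/\ footprint f' =1 A \o T', tuple_mnm T' = v & color_equiv r f f'].
Proof.
move=> r2 fT; move uE: (tuple_mnm T) => u uv.
elim: uv f T fT uE => {u v} [u v uv|u|u v w _ IH1 _ IH2] f T fT uE.
- by move: uv; rewrite -uE; apply: mstep_color_equiv.
- by exists f, T; rewrite /color_equiv connect0.
have [f1 [T1 [f1T1 T1E ff1]]] := IH1 f T fT uE.
have [f2 [T2 [f2T2 T2E f12]]] := IH2 f1 T1 f1T1 T1E.
by exists f2, T2; split=> //; apply: connect_trans f12.
Qed.

(** Unchanged colors give the common factor; the changed ones give two factors of degree at most
    [r], with equal images since both colorings have multiplicities [b]. *)
Lemma color_step_mstep b k r (f f' : edge_coloring (replicated_ends e b) k)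
    (T T' : 'I_k -> 'I_N) :
  footprint f =1 A \o T -> footprint f' =1 A \o T' ->
  color_step r f f' -> mstep a r (tuple_mnm T) (tuple_mnm T').
Proof.
move=> fT f'T'; rewrite color_step_card.
set S := [set c | _] => cS.
have eqT c : c \notin S -> T c = T' c.
  rewrite inE negbK => /eqP cc; apply: A_inj.
  by rewrite -[A _]fT -[A _]f'T' /footprint cc.
pose mS (U : 'I_k -> 'I_N) := (\sum_(c in S) U_(U c))%MM.
pose w := (\sum_(c | c \notin S) U_(T c))%MM.
have TE : tuple_mnm T =
  (w + mS T)%MM by rewrite addmC /tuple_mnm (bigID (mem S)).
have T'E : tuple_mnm T' = (w + mS T')%MM.
  rewrite addmC /tuple_mnm (bigID (mem S)) /=; congr (_ + _)%MM.
  by apply: eq_bigr => c /eqT->.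
exists w, (mS T), (mS T'); split=> //; last first.
  rewrite /mS mdeg_sum; under eq_bigr do rewrite mdeg1.
  by rewrite sum1_card.
apply/(toric_exp_add2l a w); rewrite -TE -T'E; apply/toric_exp_tuple => j.
transitivity (b j).
  by rewrite -(card_footprint e_neq0 f); apply: eq_card => c; rewrite !inE fT.
by rewrite -(card_footprint e_neq0 f'); apply: eq_card => c; rewrite !inE f'T'.
Qed.

Lemma color_equiv_mconn b k r (f g : edge_coloring (replicated_ends e b) k)
    (T T' : 'I_k -> 'I_N) :
  footprint f =1 A \o T -> footprint g =1 A \o T' ->
  color_equiv r f g -> mconn a r (tuple_mnm T) (tuple_mnm T').
Proof.
move=> fT gT' /connectP[p pP gE].
elim: p f T fT pP gE => /= [|f1 p IH] f T fT.
  move=> _ gf; suff -> : tuple_mnm T = tuple_mnm T' by apply: rt_refl.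
  apply: eq_bigr => c _; congr U_(_)%MM; apply: A_inj.
  by rewrite -[A _]fT -[A _]gT' gf.
move=> /andP[ff1 pP] gE; have [T1 f1T1] := footprint_index f1.
by apply: rt_trans (rt_step _ _ _ _ (color_step_mstep fT f1T1 ff1)) (IH _ _ f1T1 pP gE).
Qed.

Lemma connected_color_equiv r : (2 <= r)%N ->
  (forall u v, toric_exp a u = toric_exp a v -> mconn a r u v) <->
  (forall b k (f g : edge_coloring (replicated_ends e b) k), color_equiv r f g).
Proof.
move=> r2; split=> [conn b k f g|conn u v uv].
  have [T fT] := footprint_index f; have [T' gT'] := footprint_index g.
  have /conn : toric_exp a (tuple_mnm T) = toric_exp a (tuple_mnm T').
    apply/toric_exp_tuple => j; transitivity (b j).
      by rewrite -(card_footprint e_neq0 f); apply: eq_card => c;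
        rewrite !inE fT.
    by rewrite -(card_footprint e_neq0 g); apply: eq_card => c;
      rewrite !inE gT'.
  move=> /(mconn_color_equiv r2 fT)[f' [T1 [f'T1 T1E ff']]];
    apply: connect_trans ff' _.
  exact: (color_equiv_tuple_mnm r2 f'T1 gT' T1E).
have [i0 _] : exists i, set0 = A i by apply: A_all => i j; rewrite inE.
have [s s_size uE] := mnm_seq u; have [s' s'_size vE] := mnm_seq v.
rewrite -(toric_exp_mdeg uv) in s'_size.
pose k := mdeg u; pose T (c : 'I_k) := nth i0 s c;
  pose T' (c : 'I_k) := nth i0 s' c.
have TE : tuple_mnm T = u by rewrite tuple_mnm_nth -?uE.
have T'E : tuple_mnm T' = v by rewrite tuple_mnm_nth -?vE.
(* The multiplicities are read off from [u]; as [v] has the same toric image, the same multigraph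
   has a coloring with the matchings of [v]. *)
have [f fT] := coloring_exists (fun c => @A_disj (T c)).
have [|g gT' _] := recolor e_neq0 f (fun c => @A_disj (T' c)).
  move=> j; move: uv; rewrite -TE -T'E => /toric_exp_tuple/(_ j) <-.
  by apply: eq_card => c; rewrite !inE.
by rewrite -TE -T'E; apply: color_equiv_mconn (conn _ _ f g).
Qed.

End Bridge.

(** * Integer points of the matching polytope *)

Section MatchingPolytope.
Variables (R : realFieldType) (V : finType) (adj : rel V).
Variables (n : nat) (e : 'I_n -> {set V}).
Hypothesis e_lab : edge_labelling adj e.

Lemma edge_labelling_neq0 j : e j != set0.
Proof.
have : e j \in edge_set adj by rewrite -e_lab.2 imset_f.
rewrite inE => /existsP[x /existsP[y /andP[_ /eqP->]]].
by apply/set0Pn; exists x; rewrite !inE eqxx.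
Qed.

Lemma is_matching_imset (M : {set 'I_n}) :
  is_matching adj (e @: M) <-> disjoint_edges e M.
Proof.
split=> [/andP[_ /trivIsetP tM] i j iM jM ij|dM].
  by apply: tM; rewrite ?imset_f // (inj_eq e_lab.1).
apply/andP; split; first by rewrite -e_lab.2;
  apply/subsetP => _ /imsetP[j _ ->]; rewrite imset_f.
apply/trivIsetP => _ _ /imsetP[i iM ->] /imsetP[j jM ->].
by rewrite (inj_eq e_lab.1); apply: dM.
Qed.

Lemma rhoE (M : {set {set V}}) j : rho R e M 0 j = (e j \in M)%:R.
Proof.
rewrite /rho summxE big_mkcond (bigD1 j) //= big1 => [|i ij].
  by rewrite mxE !eqxx addr0; case: (_ \in _).
by rewrite mxE eq_sym (negbTE ij) andbF if_same.
Qed.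

(* A 0/1 point of the polytope is a vertex: it coincides with any [rho M] that
   has positive weight in a convex combination expressing it. *)
Lemma matching_polytope_int (z : 'rV[int]_n) :
  matching_polytope R adj e (\row_j (z 0 j)%:~R) <->
  exists2 M : {set 'I_n}, disjoint_edges e M & forall j, z 0 j = (j \in M)%:R.
Proof.
split=> [[c [c0 c1 /rowP zE]]|[M dM zM]]; last first.
  exists (fun B => (B == e @: M)%:R).
  have eM : e @: M \in [set B | is_matching adj B].
    by rewrite inE; apply/is_matching_imset.
  split=> [B _||]; first exact: ler0n.
    rewrite (bigD1 (e @: M)) //= eqxx big1 ?addr0 // => B /andP[_ /negbTE->//].
  rewrite (bigD1 (e @: M)) //= eqxx scale1r big1 ?addr0.
    by apply/rowP => j; rewrite mxE zM rhoE (mem_imset _ _ e_lab.1) natz pmulrn.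
  by move=> B /andP[_ /negbTE->]; rewrite scale0r.
have [B Bm cB] : exists2 B, B \in [set B | is_matching adj B] & 0 < c B.
  apply/exists_inP; apply: contraT; rewrite negb_exists_in => /forall_inP H.
  move: c1; rewrite big1 => [/eqP|B Bm]; first by rewrite eq_sym oner_eq0.
  by apply/eqP; rewrite eq_le c0 // andbT leNgt H.
pose M := e @^-1: B.
have eM : e @: M = B.
  apply/setP => x; apply/imsetP/idP => [[j]|xB]; first by rewrite inE => ? ->.
  have : x \in edge_set adj.
    by move: Bm; rewrite inE => /andP[/subsetP/(_ x xB)].
  by rewrite -e_lab.2 => /imsetP[j _ xj]; exists j; rewrite // inE -xj.
exists M; first by apply/is_matching_imset; rewrite eM; move: Bm; rewrite inE.
move=> j; have {zE} := zE j; rewrite mxE summxE.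
under eq_bigr do rewrite mxE rhoE.
have term_ge0 D (t : bool) : D \in [set D | is_matching adj D] ->
  0 <= c D * t%:R.
  by move=> Dm; rewrite mulr_ge0 ?c0 ?ler0n.
rewrite inE => zE; have z_ge0 : 0 <= z 0 j.
  by rewrite -(ler0z R) zE sumr_ge0 // => D; apply: term_ge0.
(* Both [z 0 j] and its complement to 1 are sums of nonnegative terms, so the integer [z 0 j] is 0
   or 1; the positive weight of [B] decides which. *)
have z_compl : 1 - (z 0 j)%:~R =
    \sum_(D in [set D | is_matching adj D]) c D * (e j \notin D)%:R.
  rewrite zE -[X in X - _]c1 -sumrB; apply: eq_bigr => D _.
  by case: (e j \in D); rewrite ?(mulr1, mulr0, subrr, subr0).
have z_le1 : z 0 j <= 1.
  by rewrite -(lerz1 R) -subr_ge0 z_compl sumr_ge0 // => D; apply: term_ge0.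
have [ejB|ejB] := boolP (e j \in B); rewrite ?mulr1n ?mulr0n.
  suff z_gt0 : 0 < z 0 j by apply/eqP; rewrite eq_le z_le1 -gtz0_ge1.
  rewrite -(ltr0z R) zE (bigD1 B) //= ejB mulr1.
  by rewrite ltr_wpDr // sumr_ge0 // => D /andP[Dm _]; apply: term_ge0.
suff z_lt1 : z 0 j < 1 by apply/eqP; rewrite eq_le z_ge0 andbT -ltzD1 add0r.
rewrite -(ltrz1 R) -subr_gt0 z_compl (bigD1 B) //= ejB mulr1.
by rewrite ltr_wpDr // sumr_ge0 // => D /andP[Dm _]; apply: term_ge0.
Qed.

(** [A i] is the support of [a i]. The integer points being the indicator vectors of matchings, the
    given list of points enumerates the matchings without repetition. *)
Lemma lattice_points_matchings N (a : 'I_N -> 'X_{1..n}) :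
    lattice_points (matching_polytope R adj e) a ->
  exists A : 'I_N -> {set 'I_n},
    [/\ forall i j, a i j = (j \in A i) :> nat, injective A,
        forall i, disjoint_edges e (A i) &
        forall M, disjoint_edges e M -> exists i, M = A i].
Proof.
move=> [a_inj aP]; pose A i := [set j | a i j != 0%N].
have Aprop i : disjoint_edges e (A i) /\ forall j, a i j = (j \in A i) :> nat.
  have /aP/matching_polytope_int[M dM zM] :
    exists i', \row_j (a i j)%:Z = \row_j (a i' j)%:Z by exists i.
  have aM j : a i j = (j \in M) :> nat.
    by have := zM j; rewrite mxE natz => -[].
  have AM : A i = M by apply/setP => j; rewrite inE aM; case: (_ \in _).
  by rewrite AM.
exists A; split=> [i j|i i' Aii'|i|M dM].
- exact: (Aprop i).2.
- by apply/a_inj/mnmP => j; rewrite !(Aprop _).2 Aii'.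
- exact: (Aprop i).1.
have /aP[i zE] : matching_polytope R adj e
    (\row_j ((\row_j ((j \in M)%:R : int)) 0 j)%:~R).
  by apply/matching_polytope_int; exists M => // j; rewrite mxE.
exists i; apply/setP => j; rewrite inE.
by have /rowP/(_ j) := zE; rewrite !mxE natz => -[<-]; case: (_ \in _).
Qed.

End MatchingPolytope.

Local Close Scope ring_scope.

Theorem theorem1p3 (R : realFieldType) (K : fieldType)
    (V : finType) (adj : rel V)
    (adj_sym : ssrbool.symmetric adj) (adj_irr : irreflexive adj)
    (n : nat) (e : 'I_n -> {set V}) (e_lab : edge_labelling adj e)
    (N : nat) (a : 'I_N -> 'X_{1..n})
    (a_pts : lattice_points (matching_polytope R adj e) a)
    (r : nat) (r_ge2 : 2 <= r) :
  omega (toric_ideal K a) <= r <->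
  (forall (b : 'I_n -> nat) (k : nat)
          (f g : edge_coloring (replicated_ends e b) k),
      color_equiv r f g).
Proof.
have [A [aE A_inj A_disj A_all]] := lattice_points_matchings e_lab a_pts.
rewrite omega_toric_ideal_le //.
exact: connected_color_equiv (edge_labelling_neq0 e_lab) aE A_inj A_disj A_all _ r_ge2.
Qed.
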